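(* Let $G^{(0)}=G$ be a seed graph with diameter $D^{(0)}$, and let $G^{(m)}$ be the Corona graph generated by $G^{(0)}$. Then the diameter $D^{(m)}$ of $G^{(m)}$ is $$D^{(m)}=D^{(0)}+2m.$$
   Context: A seed graph is a finite simple connected graph. The corona product $G_1\circ G_2$ of two graphs is obtained by taking one copy of $G_1$ and $|V(G_1)|$ copies of $G_2$, and joining the $i$-th node of $G_1$ to every node of the $i$-th copy of $G_2$, for each $i$. The Corona graphs generated by a seed graph $G$ are defined by $G^{(0)}=G$ and $G^{(m+1)}=G^{(m)}\circ G$ for $m\ge 0$. The diameter of a graph is the length of the longest shortest path in the graph.
   Formalization: For m ≥ 1 the seed graph is assumed to have at least two nodes; for the one-node seed graph the formula fails, since G^(1) is a single edge with diameter 1 rather than 2 (in general 2m − 1). *)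

(* Defs.v *)
From mathcomp Require Import all_boot.

Set Implicit Arguments.
Unset Strict Implicit.
Unset Printing Implicit Defensive.

Record sgraph := SGraph {
  vertex :> finType;
  adj : rel vertex;
  adj_sym : symmetric adj;
  adj_irrefl : irreflexive adj
}.

Arguments adj {s} x y.

Definition connected (G : sgraph) : Prop :=
  (0 < #|G|) /\ (forall x y : G, connect adj x y).

Section Distance.

Variable G : sgraph.

Definition walk_of_length (x y : G) (k : nat) : bool :=
  [exists p : k.-tuple G, path adj x p && (last x p == y)].

(* A shortest walk repeats no vertex, so lengths below #|G| suffice; when y is
   not reachable from x the value is the dummy #|G|. See [distP]. *)
Definition dist (x y : G) : nat := find (walk_of_length x y) (iota 0 #|G|).

Definition diameter : nat := \max_(x : G) \max_(y : G) dist x y.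

Lemma walk_of_lengthP (x y : G) (k : nat) :
  reflect (exists p : seq G, [/\ path adj x p, last x p = y & size p = k])
          (walk_of_length x y k).
Proof.
apply: (iffP existsP) => [[p /andP[pp /eqP lp]]|[p [pp lp /eqP sp]]].
  by exists p; rewrite size_tuple.
by exists (Tuple sp); rewrite /= pp lp eqxx.
Qed.

Lemma distP (x y : G) : connect adj x y ->
  (exists p : seq G, [/\ path adj x p, last x p = y & size p = dist x y]) /\
  (forall p : seq G, path adj x p -> last x p = y -> dist x y <= size p).
Proof.
move=> /connectP[p0 pp0 lp0].
have short (p : seq G) : path adj x p -> last x p = y ->
    exists2 k, k < #|G| & (k <= size p) && walk_of_length x y k.
  move=> + <-; case/shortenP => p' pp' up' sub; exists (size p').
    by have := max_card [in x :: p']; rewrite (card_uniqP up').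
  apply/andP; split; last by apply/walk_of_lengthP; exists p'.
  by apply: uniq_leq_size => // ; case/andP: up'.
have dist_le k : k < #|G| -> walk_of_length x y k -> dist x y <= k.
  move=> kG wk; rewrite leqNgt; apply/negP => /(before_find 0).
  by rewrite nth_iota // add0n wk.
have [k0 k0G /andP[_ wk0]] := short _ pp0 (esym lp0).
split.
  apply/walk_of_lengthP.
  have hasw : has (walk_of_length x y) (iota 0 #|G|).
    by apply/hasP; exists k0; rewrite // mem_iota.
  have := nth_find 0 hasw; rewrite nth_iota ?add0n //.
  by have := leq_ltn_trans (dist_le _ k0G wk0) k0G.
move=> p pp lp; have [k kG /andP[kp wk]] := short _ pp lp.
exact: leq_trans (dist_le _ kG wk) kp.
Qed.

End Distance.

Section Corona.

Variables G1 G2 : sgraph.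

(* [inl i] is the node i of G1; [inr (i, x)] is the node x of the i-th copy of
   G2. *)
Definition corona_vertex : finType := (G1 + G1 * G2)%type.

Definition corona_adj (u v : corona_vertex) : bool :=
  match u, v with
  | inl i, inl j => adj i j
  | inl i, inr (j, _) => i == j
  | inr (i, _), inl j => i == j
  | inr (i, x), inr (j, y) => (i == j) && adj x y
  end.

Lemma corona_adj_sym : symmetric corona_adj.
Proof.
by case=> [i|[i x]] [j|[j y]] /=; rewrite 1?(eq_sym i) 1?adj_sym.
Qed.

Lemma corona_adj_irrefl : irreflexive corona_adj.
Proof. by case=> [i|[i x]] /=; rewrite ?eqxx adj_irrefl. Qed.

Definition corona : sgraph := SGraph corona_adj_sym corona_adj_irrefl.

End Corona.

Fixpoint corona_graph (G : sgraph) (m : nat) : sgraph :=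
  if m is m'.+1 then corona (corona_graph G m') G else G.

(* Main.v *)
Require Import Defs.
From mathcomp Require Import all_boot.

(** It suffices that one corona step raises the diameter by exactly 2.  A copy
    of [G2] is attached to the rest of the corona only through its base node,
    so going from a copy node over [i] to one over [j] costs at most
    [1 + dist i j + 1]; and it costs that much when [i != j], because a
    1-Lipschitz function drops by [dist i j + 2] between the two nodes. *)

(** The walk itself witnesses the reachability that [distP] asks for, so the dummy value of [dist]
    cannot occur. *)
Lemma dist_le_size (G : sgraph) (x : G) (p : seq G) :
  path adj x p -> dist x (last x p) <= size p.
Proof.
move=> pp; have /distP[_] : connect adj x (last x p) by apply/connectP; exists p.
exact.
Qed.

Lemma dist_self (G : sgraph) (x : G) : dist x x = 0.
Proof. by apply/eqP; rewrite -leqn0; apply: (@dist_le_size G x [::]). Qed.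

Lemma shortest_path (G : sgraph) (x y : G) : connected G ->
  exists p : seq G, [/\ path adj x p, last x p = y & size p = dist x y].
Proof. by case=> _ /(_ x y)/distP[]. Qed.

Lemma dist_eq0 (G : sgraph) (x y : G) : connected G ->
  (dist x y == 0) = (x == y).
Proof.
move=> cG; apply/eqP/eqP => [d0|->]; last exact: dist_self.
have [p [_ lp]] := shortest_path _ x y cG; rewrite d0 => /size0nil p0.
by rewrite -lp p0.
Qed.

Lemma dist_adj (G : sgraph) (x y z : G) : connected G ->
  adj x y -> dist x z <= (dist y z).+1.
Proof.
move=> cG xy; have [p [pp lp <-]] := shortest_path _ y z cG.
by rewrite -lp; apply: (@dist_le_size G x (y :: p)); rewrite /= xy.
Qed.

(** Each edge of a shortest path lowers [h] by at most 1. A well-chosen [h] thus yields a lower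
    bound on distance. *)
Lemma lipschitz_dist (G : sgraph) (h : G -> nat) (x y : G) : connected G ->
  (forall u v : G, adj u v -> h u <= (h v).+1) -> h x <= h y + dist x y.
Proof.
move=> cG hlip; have [p [pp <- <-]] := shortest_path _ x y cG.
elim: p x pp => [|z p IHp] x /=; first by rewrite addn0.
by case/andP=> /hlip/leq_trans le_h /IHp le_z; rewrite addnS le_h.
Qed.

Lemma dist_le_diameter (G : sgraph) (x y : G) : dist x y <= diameter G.
Proof.
rewrite /diameter (bigD1 x) //= leq_max; apply/orP; left.
exact: (leq_bigmax y).
Qed.

Lemma diameter_attained (G : sgraph) : 0 < #|G| ->
  exists x y : G, diameter G = dist x y.
Proof.
move=> G0; have [x dx] := eq_bigmax (fun x : G => \max_(y : G) dist x y) G0.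
by have [y dy] := eq_bigmax (dist x) G0; exists x, y; rewrite /diameter dx.
Qed.

Lemma diameter_gt0 (G : sgraph) : connected G -> 1 < #|G| -> 0 < diameter G.
Proof.
move=> cG /card_gt1P[x [y [_ _ neq_xy]]].
by apply: leq_trans (dist_le_diameter G x y); rewrite lt0n dist_eq0.
Qed.

Definition corona_base {G1 G2 : sgraph} (u : corona G1 G2) : G1 :=
  match u with inl i => i | inr (i, _) => i end.

(** Route through the bases: step down from [u] if it is a copy node, follow a shortest path of
    [G1], step up to [v] if it is a copy node. This gives both connectedness and the upper bound on
    distances. *)
Lemma corona_walk (G1 G2 : sgraph) (u v : corona G1 G2) : connected G1 ->
  exists p : seq (corona G1 G2), [/\ path adj u p, last u p = v
    & size p <= dist (corona_base u) (corona_base v) + 2].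
Proof.
move=> cG; have [p [pp lp sp]] := shortest_path _ (corona_base u) (corona_base v) cG.
have [q [pq lq sq]] : exists q : seq (corona G1 G2),
    [/\ path (@adj (corona G1 G2)) (inl (corona_base u)) q,
        last (inl (corona_base u)) q = inl (corona_base v)
      & size q = dist (corona_base u) (corona_base v)].
  by exists (map inl p); rewrite path_map last_map size_map lp.
rewrite -sq; case: u v {p pp lp sp sq} pq lq => [i|[i x]] [j|[j y]] /= pq lq.
- by exists q; rewrite leq_addr.
- exists (rcons q (inr (j, y))).
  by rewrite rcons_path last_rcons size_rcons pq lq /= eqxx addn2.
- by exists (inl i :: q); rewrite /= eqxx pq addn2.
- exists (inl i :: rcons q (inr (j, y))).
  rewrite /= rcons_path last_rcons size_rcons pq lq /= !eqxx.
  by rewrite addn2.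
Qed.

Lemma connected_corona (G1 G2 : sgraph) : connected G1 ->
  connected (corona G1 G2).
Proof.
move=> cG; split; first by rewrite card_sum ltn_addr //; case: cG.
move=> u v; have [p [pp lp _]] := corona_walk G1 G2 u v cG.
by apply/connectP; exists p.
Qed.

Lemma dist_corona_le (G1 G2 : sgraph) (u v : corona G1 G2) : connected G1 ->
  dist u v <= dist (corona_base u) (corona_base v) + 2.
Proof.
move=> cG; have [p [pp <- sp]] := corona_walk G1 G2 u v cG.
exact: leq_trans (dist_le_size _ _ _ pp) sp.
Qed.

Lemma dist_corona_ge (G1 G2 : sgraph) (i j : G1) (x y : G2) : connected G1 ->
  i != j -> dist i j + 2 <= dist (inr (i, x) : corona G1 G2) (inr (j, y)).
Proof.
move=> cG neq_ij.
(* The distance to the copy over [j]. *)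
pose h (u : corona G1 G2) := match u with
  | inl k => (dist k j).+1
  | inr (k, _) => if k == j then 0 else dist k j + 2
  end.
suff hlip u v : adj u v -> h u <= (h v).+1.
  have := lipschitz_dist _ h (inr (i, x)) (inr (j, y)) (connected_corona _ _ cG) hlip.
  by rewrite /= eqxx (negPf neq_ij).
case: u v => [k|[k z]] [l|[l t]] /=.
- by move/(dist_adj _ _ _ j cG).
(* Entering a copy from its base lowers [h] only over [j], and there only from 1 to 0, since
   [dist j j = 0]. *)
- move=> /eqP <-; case: eqP => [->|_]; first by rewrite dist_self.
  by rewrite addn2 ltnS; do 2!apply: leqW.
- by move=> /eqP <-; case: eqP => // _; rewrite addn2.
- by case/andP=> /eqP <- _.
Qed.

(** Two nodes in [G1] ensure that a farthest pair has distinct bases. For a single node the formula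
    can fail: the corona of two one-node graphs is an edge, of diameter 1 rather than 2. *)
Lemma diameter_corona (G1 G2 : sgraph) : connected G1 -> 1 < #|G1| ->
  0 < #|G2| -> diameter (corona G1 G2) = diameter G1 + 2.
Proof.
move=> cG G1_gt1 /card_gt0P[x _]; apply/eqP; rewrite eqn_leq; apply/andP; split.
  have [u [v ->]] := diameter_attained _ (proj1 (connected_corona _ G2 cG)).
  by apply: leq_trans (dist_corona_le _ _ u v cG) _; rewrite leq_add2r dist_le_diameter.
have [i [j dij]] := diameter_attained _ (proj1 cG).
have neq_ij : i != j by rewrite -dist_eq0 // -dij -lt0n diameter_gt0.
(* The same node [x] serves in both copies, as only the bases [i] and [j] affect the bound. *)
rewrite dij; apply: leq_trans (dist_corona_ge _ _ i j x x cG neq_ij) _.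
exact: dist_le_diameter.
Qed.

Lemma connected_corona_graph (G : sgraph) (m : nat) :
  connected G -> connected (corona_graph G m).
Proof. by move=> cG; elim: m => //= m; apply: connected_corona. Qed.

(** Carries the bound [1 < #|G|] to every iterate, so that [diameter_corona] applies at each
    step. *)
Lemma card_corona_graph (G : sgraph) (m : nat) : #|G| <= #|corona_graph G m|.
Proof. by elim: m => //= m /leq_trans; apply; rewrite card_sum leq_addr. Qed.

Theorem theorem2 (G : sgraph) (m : nat) (hconn : connected G)
    (hnontriv : 0 < m -> 1 < #|G|) :
  diameter (corona_graph G m) = diameter G + 2 * m.
Proof.
elim: m hnontriv => [|m IHm] G_gt1; first by rewrite muln0 addn0.
have {}G_gt1 := G_gt1 isT.
rewrite /= diameter_corona ?IHm //.
- by rewrite mulnS [2 + _]addnC addnA.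
- exact: connected_corona_graph.
- exact: leq_trans G_gt1 (card_corona_graph G m).
- exact: ltnW.
Qed.
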